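(* Let $m\ge1$ be an integer and $\alpha\in(0,1]$. There is a constant $C$ depending only on $m$ and $\alpha$ such that the following holds. Let $I=(t_0-\delta,t_0+\delta)$ with $t_0\in\mathbb{R}$ and $\delta>0$. If $f\in C^{m,\alpha}(\overline I)$ is a (real valued) function such that $f$ and $f'$ do not change their sign on $I$, then for all $s=1,\ldots,m$, $$|f^{(s)}(t_0)|\le C|I|^{-s}\Big(|f(t_0)|+|f(t_0)|^{(m+\alpha-s)/(m+\alpha)}\big(\mathrm{H\ddot{o}ld}_{\alpha,I}(f^{(m)})\big)^{s/(m+\alpha)}|I|^s\Big).$$
   Context: $|I|$ is the length of $I$. $\mathrm{H\ddot{o}ld}_{\alpha,I}(g)=\sup_{x\ne y\in I}|g(x)-g(y)|/|x-y|^\alpha$. $C^{m,\alpha}(\overline I)$ is the space of $C^m$-functions on $I$ whose derivatives of order $\le m$ extend continuously to $\overline I$ and with $\mathrm{H\ddot{o}ld}_{\alpha,I}(f^{(m)})<\infty$. *)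

(* Defs.v *)
From HB Require Import structures.
From mathcomp Require Import all_boot all_order all_algebra.
From mathcomp Require Import all_classical all_reals all_analysis.
Set Implicit Arguments.
Unset Strict Implicit.
Unset Printing Implicit Defensive.
Import Order.TTheory GRing.Theory Num.Theory.
Import numFieldNormedType.Exports.
Local Open Scope ring_scope.
Local Open Scope classical_set_scope.

(* A function on an open set I is represented by a total function R -> R; all
   notions below depend only on its values on I when I is open. *)

Definition hoelder_quotients (R : realType) (alpha : R) (I : set R)
    (g : R -> R) : set (\bar R) :=
  [set z | exists x y, [/\ I x, I y, x != y &
                         z = (`|g x - g y| / `|x - y| `^ alpha)%:E]].

Definition hoelder_sup (R : realType) (alpha : R) (I : set R) (g : R -> R) :
    \bar R :=
  ereal_sup (hoelder_quotients alpha I g).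

Definition Cm_on (R : realType) (m : nat) (I : set R) (f : R -> R) : Prop :=
  (forall k x, (k < m)%N -> I x -> derivable (f^`(k)) x 1) /\
  (forall k, (k <= m)%N -> {within I, continuous f^`(k)}).

Definition extends_to_closure (R : realType) (I : set R) (g : R -> R) : Prop :=
  exists h : R -> R,
    {within closure I, continuous h} /\ (forall x, I x -> h x = g x).

(* The space $C^{m,\alpha}(\overline I)$ for an open set I. *)
Definition Cm_hoelder (R : realType) (m : nat) (alpha : R) (I : set R)
    (f : R -> R) : Prop :=
  [/\ Cm_on m I f,
      forall k, (k <= m)%N -> extends_to_closure I (f^`(k)) &
      (hoelder_sup alpha I (f^`(m)) < +oo)%E].

Definition no_sign_change (R : realType) (I : set R) (g : R -> R) : Prop :=
  (forall x, I x -> 0 <= g x) \/ (forall x, I x -> g x <= 0).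

Definition set_length (R : realType) (I : set R) : R := fine (lebesgue_measure I).

(* Main.v *)
Require Import Defs.
From HB Require Import structures.
From mathcomp Require Import all_boot all_order all_algebra.
From mathcomp Require Import all_classical all_reals all_analysis.
From mathcomp Require Import ring lra.
Import Order.TTheory GRing.Theory Num.Theory.
Import numFieldNormedType.Exports.
Local Open Scope ring_scope.
Local Open Scope classical_set_scope.

(* Monotonicity gives |f| <= |f(t0)| on one side of t0, where by Taylor's
   formula f is within H h^(m+alpha) of its Taylor polynomial at t0, for each scale
   h <= delta. So that polynomial is bounded by |f(t0)| + H h^(m+alpha) at m+1
   equally spaced nodes, and inverting a Vandermonde matrix bounds its
   coefficients: |f^(s)(t0)| h^s <= C (|f(t0)| + H h^(m+alpha)). It remains to
   take h = min(delta, (|f(t0)|/H)^(1/(m+alpha))), or to let h tend to 0 if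
   f(t0) = 0. *)

(** The values at the distinct nodes [j / n] are the coefficient row times an invertible Vandermonde
    matrix. The sum of the absolute values of all entries of the inverse therefore serves as [K],
    crudely but depending on [n] only. *)
Lemma poly_coef_bound (R : realType) (n : nat) :
  exists2 K : R, 0 <= K & forall (p : {poly R}) (B : R), (size p <= n)%N ->
    (forall j : 'I_n, `|p.[j%:R / n%:R]| <= B) ->
    forall i, (i < n)%N -> `|p`_i| <= K * B.
Proof.
pose a : 'rV[R]_n := \row_j (j%:R / n%:R).
pose V := Vandermonde n a.
have Vunit : V \in unitmx.
  rewrite unitmxE det_Vandermonde unitfE.
  apply/prodf_neq0 => i _; apply/prodf_neq0 => j ij; rewrite !mxE -mulrBl.
  rewrite mulf_neq0 ?invr_eq0 ?pnatr_eq0 ?subr_eq0 ?eqr_nat ?gtn_eqF//.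
  exact: leq_ltn_trans (leq0n _) (ltn_ord i).
exists (\sum_j \sum_i `|invmx V j i|).
  by apply: sumr_ge0 => j _; apply: sumr_ge0.
move=> p B sp pB i ltin; pose i' := Ordinal ltin.
pose c : 'rV[R]_n := \row_k p`_k.
have cV j : (c *m V) 0 j = p.[j%:R / n%:R].
  rewrite mxE (horner_coef_wide _ sp).
  by apply: eq_bigr => k _; rewrite !mxE.
have -> : p`_i = (c *m V *m invmx V) 0 i' by rewrite mulmxK// mxE.
rewrite mxE (le_trans (ler_norm_sum _ _ _))// mulr_suml ler_sum// => j _.
rewrite normrM cV mulrC.
have B0 : 0 <= B by rewrite (le_trans _ (pB j)).
apply: ler_pM => //.
by rewrite (bigD1 i')//= lerDl sumr_ge0.
Qed.

(** Covers [x] on either side of [t0]. The position of [c] is recorded only through its distance to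
    [t0], which is what the remainder estimate in [taylor_hoelder] consumes. *)
Lemma MVT_sym {R : realType} (a b t0 x : R) (g dg : R -> R) :
  (forall y, y \in `]a, b[%R -> is_derive y 1 g (dg y)) ->
  t0 \in `]a, b[%R -> x \in `]a, b[%R ->
  exists c, [/\ c \in `]a, b[%R, `|c - t0| <= `|x - t0| &
                g x - g t0 = dg c * (x - t0)].
Proof.
move=> dgP t0I xI.
have sub u v : u \in `]a, b[%R -> v \in `]a, b[%R ->
    forall y, y \in `[u, v]%R -> y \in `]a, b[%R.
  move=> uI vI y yI; rewrite in_itv/= (lt_le_trans (_ : a < u));
    rewrite ?(itvP uI) ?(itvP yI)//.
  by rewrite (le_lt_trans (_ : y <= v)) ?(itvP vI) ?(itvP yI).
have suboo u v : u \in `]a, b[%R -> v \in `]a, b[%R ->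
    forall y, y \in `]u, v[%R -> is_derive y 1 g (dg y).
  by move=> uI vI y yuv; apply/dgP/(sub u v) => //; exact: subset_itv_oo_cc yuv.
have cont u v : u \in `]a, b[%R -> v \in `]a, b[%R ->
    {within `[u, v], continuous g}.
  move=> uI vI; apply: derivable_within_continuous => y yuv.
  by have /@ex_derive := dgP _ (sub _ _ uI vI _ yuv).
case: (leP t0 x) => [t0x|/ltW xt0].
  have [c cI ->] := MVT_segment t0x (suboo _ _ t0I xI) (cont _ _ t0I xI).
  exists c; split; rewrite ?(sub _ _ t0I xI)//.
  by rewrite !ger0_norm ?subr_ge0 ?lerD2r// (itvP cI).
have [c cI eq] := MVT_segment xt0 (suboo _ _ xI t0I) (cont _ _ xI t0I).
exists c; split; rewrite ?(sub _ _ xI t0I)//.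
  by rewrite !ler0_norm ?subr_le0 ?lerN2 ?lerD2r// (itvP cI).
by rewrite -opprB eq -mulrN opprB.
Qed.

(** [F k] stands for the k-th derivative, and the variable is the increment from [t0]. With a
    sequence of functions, differentiation becomes the shift [F \o succn], which suits induction on
    [n]. *)
Definition taylor_poly {R : realType} (F : nat -> R -> R) (t0 : R) (n : nat)
    : {poly R} :=
  \poly_(k < n.+1) (F k t0 / k`!%:R).

Lemma deriv_taylor_poly {R : realType} (F : nat -> R -> R) (t0 : R) (n : nat) :
  deriv (taylor_poly F t0 n.+1) = taylor_poly (F \o succn) t0 n.
Proof.
apply/polyP => i; rewrite coef_deriv !coef_poly ltnS.
case: ltnP => _; last by rewrite mul0rn.
rewrite /= factS natrM -mulrnAr; congr (_ * _).
by rewrite invfM -mulrnAl -[_ *+ _]mulr_natr mulVf ?mul1r ?pnatr_eq0.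
Qed.

(** Induction on [n]: the remainder vanishes at [t0] and its derivative is the remainder of the
    shifted sequence, so each use of the mean value theorem gains one factor [|x - t0|]. The
    constant stays [H]. *)
Lemma taylor_hoelder {R : realType} (a b t0 H al : R) (n : nat)
    (F : nat -> R -> R) :
  t0 \in `]a, b[%R -> 0 <= al -> 0 <= H ->
  (forall k y, (k < n)%N -> y \in `]a, b[%R ->
    is_derive y 1 (F k) (F k.+1 y)) ->
  (forall y, y \in `]a, b[%R -> `|F n y - F n t0| <= H * `|y - t0| `^ al) ->
  forall x, x \in `]a, b[%R ->
    `|F 0%N x - (taylor_poly F t0 n).[x - t0]| <= H * `|x - t0| `^ (n%:R + al).
Proof.
move=> t0I al0 H0; elim: n F => [|n IH] F dF HF x xI.
  by rewrite horner_poly big_ord1 expr0 mulr1 fact0 divr1 add0r HF.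
have {}IH := IH (F \o succn) (fun k y kn => dF k.+1 y kn) HF.
pose g y := F 0%N y - (taylor_poly F t0 n.+1).[y - t0].
have dg y : y \in `]a, b[%R ->
    is_derive y 1 g (F 1%N y - (taylor_poly (F \o succn) t0 n).[y - t0]).
  move=> yI; apply: is_deriveB; first exact: dF.
  rewrite -deriv_taylor_poly -[_.[_]]mulr1.
  exact: (is_derive1_comp (is_derive_poly _ _) (is_derive_shift y 1 (- t0))).
have [c [cI ct0]] := MVT_sym _ _ _ _ _ _ dg t0I xI.
have -> : g t0 = 0.
  by rewrite /g subrr horner_coef0 coef_poly/= fact0 divr1 subrr.
rewrite subr0 => eqg; rewrite -/(g x) eqg normrM.
have [->|xt0] := eqVneq x t0.
  by rewrite subrr normr0 mulr0 mulr_ge0 ?powR_ge0.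
rewrite -natr1 -addrA [1 + al]addrC addrA.
rewrite powRD ?normr_eq0 ?subr_eq0 ?xt0 ?implybT//.
rewrite powRr1// mulrA ler_wpM2r// (le_trans (IH c cI))// ler_wpM2l//.
by rewrite ge0_ler_powR ?nnegrE ?addr_ge0.
Qed.

(** Constant signs of [f] and [f'] make [|f|] monotone. The side where it does not exceed [|f t0|]
    is the left one ([b = true]) if the signs agree and the right one otherwise. *)
Lemma norm_le_one_side {R : realType} (t0 d : R) (f : R -> R) :
  let I := `]t0 - d, t0 + d[%R in 0 < d ->
  (forall x, x \in I -> derivable f x 1) ->
  no_sign_change [set` I] f -> no_sign_change [set` I] (f^`()) ->
  exists b : bool, forall u, 0 <= u < d ->
    `|f (t0 + (-1) ^+ b * u)| <= `|f t0|.
Proof.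
move=> I d0 df fS f'S.
have cf : {in `]t0 - d, t0 + d[, continuous f}.
  move=> x /set_mem xI.
  exact/differentiable_continuous/derivable1_diffP/df.
have t0I : t0 \in I by rewrite in_itv/=; apply/andP; split; lra.
have uI (b : bool) u : 0 <= u < d -> t0 + (-1) ^+ b * u \in I.
  move=> /andP[u0 ud]; rewrite in_itv/=; apply/andP.
  by case: b; rewrite ?expr1 ?expr0; split; lra.
case: f'S => f'S; case: fS => fS.
- exists true => u ud; rewrite !ger0_norm ?fS//; last exact: uI.
  apply: (ger0_derive1_le_oo df f'S cf) => //; first exact: uI.
  by case/andP: ud => u0 _; rewrite expr1; lra.
- exists false => u ud; rewrite !ler0_norm ?fS ?lerN2//; last exact: uI.
  apply: (ger0_derive1_le_oo df f'S cf) => //; first exact: uI.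
  by case/andP: ud => u0 _; rewrite expr0; lra.
- exists false => u ud; rewrite !ger0_norm ?fS//; last exact: uI.
  apply: (ler0_derive1_le_oo df f'S cf) => //; first exact: uI.
  by case/andP: ud => u0 _; rewrite expr0; lra.
- exists true => u ud; rewrite !ler0_norm ?fS ?lerN2//; last exact: uI.
  apply: (ler0_derive1_le_oo df f'S cf) => //; first exact: uI.
  by case/andP: ud => u0 _; rewrite expr1; lra.
Qed.

(** The two terms of the conclusion come from different regimes: [h = d] when [A] dominates
    [H * d ^ p], and otherwise the scale at which [A] and [H * h ^ p] balance. *)
Lemma le_optimal_scale {R : realType} (A H M y d p : R) (s : nat) :
  0 <= A -> 0 <= H -> 0 <= M -> 0 < d -> s%:R < p ->
  (forall h, 0 < h <= d -> y * h ^+ s <= M * (A + H * h `^ p)) ->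
  y <= 2 * M * (d ^- s * A + A `^ ((p - s%:R) / p) * H `^ (s%:R / p)).
Proof.
move=> A0 H0 M0 d0 sp yP.
have p0 : 0 < p by rewrite (le_lt_trans _ sp).
have B0 : 0 <= A `^ ((p - s%:R) / p) * H `^ (s%:R / p).
  by rewrite mulr_ge0 ?powR_ge0.
have [HA|AH] := leP (H * d `^ p) A.
  have ds : 0 < d ^+ s by rewrite exprn_gt0.
  apply: (@le_trans _ _ (2 * M * (d ^- s * A))); last first.
    by rewrite ler_wpM2l ?mulr_ge0// lerDl.
  rewrite mulrCA [d ^- s * _]mulrC ler_pdivlMr//.
  apply: le_trans (yP d _) _; first by rewrite d0/=.
  by rewrite -mulrA mulrCA ler_wpM2l//; lra.
have Hgt0 : 0 < H.
  rewrite lt0r H0 andbT; apply: contraTneq AH => ->.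
  by rewrite mul0r -leNgt.
have [Aeq0|An0] := eqVneq A 0.
  (* Here the balancing scale degenerates to 0. Instead [y <= M * H * h ^ (p - s)] for all small
     [h], and [p - s > 0] forces [y <= 0]. *)
  suff : y <= 0.
    move=> y0; rewrite (le_trans y0)// !mulr_ge0// addr_ge0// mulr_ge0//.
    by rewrite invr_ge0 exprn_ge0// ltW.
  rewrite leNgt; apply/negP => y0.
  pose q := p - s%:R; have q0 : 0 < q by rewrite subr_gt0.
  (* Chosen so that [M * H * e < y]; the [+ 1] keeps the denominator positive even if
     [M * H = 0]. *)
  pose e := y / (2 * (M * H + 1)).
  have MH : 0 <= M * H by rewrite mulr_ge0.
  have e0 : 0 < e by rewrite divr_gt0//; lra.
  pose h := Num.min d (e `^ q^-1).
  have h0 : 0 < h by rewrite lt_min d0 powR_gt0.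
  have hq : h `^ q <= e.
    rewrite -[leRHS](powRr1 (ltW e0)) -(mulVf (lt0r_neq0 q0)) powRrM.
    rewrite ge0_ler_powR ?nnegrE ?powR_ge0//; [exact: ltW|exact: ltW|].
    by rewrite ge_min lexx orbT.
  have := yP h; rewrite h0 ge_min lexx => /(_ isT).
  rewrite Aeq0 add0r -(subrK s%:R p) -/q powRD ?(gt_eqF h0) ?implybT//.
  rewrite powR_mulrn ?(ltW h0)// !mulrA ler_pM2r ?exprn_gt0// => yle.
  have : M * H * h `^ q <= M * H * e by rewrite ler_wpM2l.
  have : e * (2 * (M * H + 1)) = y by rewrite mulfVK//; lra.
  nra.
have Agt0 : 0 < A by rewrite lt0r An0.
(* The solution of [H * h ^ p = A]; it is at most [d] because [A < H * d ^ p]. *)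
pose h := (A / H) `^ p^-1.
have AH0 : 0 < A / H by rewrite divr_gt0.
have h0 : 0 < h by rewrite powR_gt0.
have hp : h `^ p = A / H by rewrite -powRrM mulVf ?lt0r_neq0// powRr1// ltW.
have hd : h <= d.
  rewrite -[leRHS](powRr1 (ltW d0)) -(mulfV (lt0r_neq0 p0)) powRrM.
  rewrite ge0_ler_powR ?nnegrE ?powR_ge0 ?invr_ge0 ?(ltW p0) ?(ltW AH0)// ltW//.
  by rewrite ltr_pdivrMr// mulrC.
have hs : h ^+ s = (A / H) `^ (s%:R / p).
  by rewrite -powR_mulrn ?(ltW h0)// -powRrM [p^-1 * _]mulrC.
have := yP h; rewrite h0 hd => /(_ isT).
rewrite hp mulrCA mulfV ?lt0r_neq0// mulr1 => yle.
set B := _ * H `^ _ in B0 *.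
apply: (@le_trans _ _ (2 * M * B)); last first.
  by rewrite ler_wpM2l ?mulr_ge0// lerDr mulr_ge0// invr_ge0 exprn_ge0// ltW.
(* After multiplication by [h ^ s = (A / H) ^ (s / p)], the powers of [H] cancel and [B * h ^ s] is
   exactly [A]. *)
rewrite -(ler_pM2r (exprn_gt0 s h0)) (le_trans yle)// hs /B -!mulrA.
rewrite -powRM ?(ltW Hgt0) ?(ltW AH0)// [H * _]mulrC mulfVK ?lt0r_neq0//.
rewrite -powRD ?An0 ?implybT// -mulrDl subrK mulfV ?lt0r_neq0// powRr1//.
by lra.
Qed.

Lemma hoelder_sup_bound {R : realType} (al a b : R) (g : R -> R) :
  let I := [set` `]a, b[%R] in a < b ->
  (hoelder_sup al I g < +oo)%E ->
  0 <= fine (hoelder_sup al I g) /\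
  forall x y, I x -> I y ->
    `|g x - g y| <= fine (hoelder_sup al I g) * `|x - y| `^ al.
Proof.
move=> I ab Hoo.
have quo_le x y : I x -> I y -> x != y ->
    ((`|g x - g y| / `|x - y| `^ al)%:E <= hoelder_sup al I g)%E.
  by move=> Ix Iy xy; apply: ereal_sup_ubound; exists x, y.
have H0 : (0 <= hoelder_sup al I g)%E.
  (* Two distinct points of the interval provide a quotient, so the supremum is not that of the
     empty set, [-oo]. *)
  apply: le_trans (quo_le ((a + a + b) / 3) ((a + b + b) / 3) _ _ _).
  - by rewrite lee_fin divr_ge0 ?powR_ge0.
  - by rewrite /I/= in_itv/=; apply/andP; split; lra.
  - by rewrite /I/= in_itv/=; apply/andP; split; lra.
  - by apply/negP => /eqP; lra.
have Hfin : hoelder_sup al I g \is a fin_num by rewrite ge0_fin_numE.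
split; first exact: fine_ge0.
move=> x y Ix Iy; have [->|xy] := eqVneq x y.
  by rewrite subrr normr0 mulr_ge0 ?fine_ge0 ?powR_ge0.
rewrite -ler_pdivrMr ?powR_gt0 ?normr_gt0 ?subr_eq0//.
by rewrite -lee_fin fineK// quo_le.
Qed.

Lemma set_length_oo {R : realType} (a b : R) :
  a <= b -> set_length [set` `]a, b[%R] = b - a.
Proof.
rewrite /set_length lebesgue_measure_itv/= lte_fin le_eqVlt.
by case: ltgtP => //= -> _; rewrite subrr.
Qed.

Theorem corollary3 (R : realType) (m : nat) (alpha : R)
    (hm : (1 <= m)%N) (halpha : 0 < alpha <= 1) :
  exists C : R, forall (t0 delta : R) (f : R -> R), 0 < delta ->
    let I : set R := [set` `]t0 - delta, t0 + delta[%R] in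
    Cm_hoelder m alpha I f ->
    no_sign_change I f -> no_sign_change I (f^`()) ->
    forall s : nat, (1 <= s <= m)%N ->
      `|f^`(s) t0| <=
        C * set_length I ^- s *
        (`|f t0| +
         `|f t0| `^ ((m%:R + alpha - s%:R) / (m%:R + alpha)) *
         fine (hoelder_sup alpha I (f^`(m))) `^ (s%:R / (m%:R + alpha)) *
         set_length I ^+ s).
Proof.
case/andP: halpha => al0 _.
have [K K0 KP] := poly_coef_bound R m.+1.
have M0 : 0 <= m`!%:R * K by rewrite mulr_ge0.
(* The factor 2 comes from [le_optimal_scale], the factorial from the Taylor denominators
   [s! <= m!], and [2 ^ m] from the interval having length [2 * d] rather than [d]. *)
exists (2 * (m`!%:R * K) * 2 ^+ m) => t0 d f d0 I.
move=> [[df _] _ Hoo] fS f'S s /andP[_ sm].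
have [H0 Hf] : 0 <= fine (hoelder_sup alpha I f^`(m)%classic) /\
    forall x y, I x -> I y -> `|f^`(m)%classic x - f^`(m)%classic y| <=
      fine (hoelder_sup alpha I f^`(m)%classic) * `|x - y| `^ alpha.
  by apply: hoelder_sup_bound => //; lra.
rewrite set_length_oo; last lra.
rewrite (_ : t0 + d - (t0 - d) = 2 * d); last ring.
set H := fine _ in H0 Hf *; set A := `|f t0|; set p := m%:R + alpha.
have p0 : 0 < p by rewrite ltr_wpDl.
have t0I : t0 \in `]t0 - d, t0 + d[%R.
  by rewrite in_itv/=; apply/andP; split; lra.
have [b fb] := norm_le_one_side _ _ _ d0 (fun x => df 0%N x hm) fS f'S.
have dF k y : (k < m)%N -> y \in `]t0 - d, t0 + d[%R ->
    is_derive y 1 f^`(k)%classic (f^`(k.+1)%classic y).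
  by move=> km yI; rewrite derive1nS derive1E; apply/derivableP/df.
have taylor := taylor_hoelder _ _ _ _ _ _ _ t0I (ltW al0) H0 dF
  (fun y yI => Hf y t0 yI t0I).
set P := taylor_poly _ _ _ in taylor.
have scale h : 0 < h <= d ->
    `|f^`(s)%classic t0| * h ^+ s <= m`!%:R * K * (A + H * h `^ p).
  move=> /andP[h0 hd].
  (* The Taylor polynomial rescaled by [h] towards the good side: the nodes in [[0, 1)] land where
     [|f| <= |f t0|], and the s-th coefficient has absolute value [|f^(s) t0| * h ^ s / s!]. *)
  pose Q : {poly R} := \poly_(k < m.+1) (P`_k * ((-1) ^+ b * h) ^+ k).
  have Qnode (j : 'I_m.+1) : `|Q.[j%:R / m.+1%:R]| <= A + H * h `^ p.
    set x := j%:R / _.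
    (* Strictness at 1 keeps the evaluation point inside the open interval even when [h = d]. *)
    have /andP[x0 x1] : 0 <= x < 1.
      by rewrite divr_ge0//= ltr_pdivrMr ?ltr0n// mul1r ltr_nat.
    have -> : Q.[x] = P.[t0 + (-1) ^+ b * (h * x) - t0].
      rewrite horner_poly (horner_coef_wide _ (size_poly _ _)).
      apply: eq_bigr => k _; rewrite -mulrA -exprMn; congr (_ * _ ^+ _).
      by ring.
    set t := t0 + _.
    have hx0 : 0 <= h * x by rewrite mulr_ge0// ltW.
    have hxh : h * x <= h by rewrite ler_piMr ?ltW.
    have hxd : 0 <= h * x < d.
      by rewrite hx0/= (lt_le_trans _ hd)// gtr_pMr.
    have tt0 : `|t - t0| = h * x.
      by rewrite /t addrC addKr normrM normr_sign mul1r ger0_norm.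
    have tI : t \in `]t0 - d, t0 + d[%R.
      case/andP: hxd => _; rewrite -tt0 ltr_norml in_itv/= => /andP[? ?].
      by apply/andP; split; lra.
    (* Triangle inequality: [|f t|] is controlled by monotonicity, and [|P - f|] at [t] by the
       Taylor remainder. *)
    rewrite -[P.[_]](subrK (f t)) (le_trans (ler_normD _ _))// addrC lerD ?fb//.
    rewrite distrC (le_trans (taylor _ tI))// tt0 ler_wpM2l//.
    by rewrite ge0_ler_powR ?nnegrE ?(ltW p0) ?(ltW h0).
  have := KP _ _ (size_poly _ _) Qnode s sm.
  rewrite !coef_poly ltnS sm exprMn !normrM !normrX normrN1 !expr1n mul1r.
  rewrite [`|h|]gtr0_norm// [`|_^-1|]ger0_norm// => Ks.
  have : `|f^`(s)%classic t0| * h ^+ s <= s`!%:R * (K * (A + H * h `^ p)).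
    rewrite -ler_pdivrMl ?ltr0n ?fact_gt0//; apply: le_trans Ks.
    by rewrite mulrCA mulrA.
  move=> /le_trans; apply; rewrite -mulrA ler_wpM2r ?ler_nat ?leq_fact//.
  by rewrite mulr_ge0 ?addr_ge0 ?mulr_ge0 ?powR_ge0 ?normr_ge0.
have sp : s%:R < p by rewrite ltr_pwDr// ler_nat.
have := le_optimal_scale _ _ _ _ _ _ _ (normr_ge0 _) H0 M0 d0 sp scale.
move=> /le_trans; apply.
have : 0 <= A `^ ((p - s%:R) / p) * H `^ (s%:R / p).
  by rewrite mulr_ge0 ?powR_ge0.
rewrite -/A; move: (_ * H `^ _) => B B0.
have X0 : 0 <= d ^- s * A.
  by rewrite mulr_ge0 ?normr_ge0 ?invr_ge0 ?exprn_ge0 ?(ltW d0).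
move: (2 * _) (mulr_ge0 (ler0n R 2) M0) => M1 M10.
rewrite -!mulrA ler_wpM2l//.
have -> : 2 ^+ m * ((2 * d) ^- s * (A + B * (2 * d) ^+ s)) =
    2 ^+ (m - s) * (d ^- s * A) + 2 ^+ m * B.
  rewrite -[in 2 ^+ m](subnK sm) exprD exprMn; field.
  by rewrite !expf_neq0// ?pnatr_eq0// lt0r_neq0.
by rewrite lerD// ler_peMl// exprn_ege1// ler1n.
Qed.
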